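(* Let $X$ be a real inner product space of finite even dimension, and let $V,W\subset X$ be nonzero real subspaces of even dimension. Then $V$ and $W$ are not simultaneously complexifiable in the following cases: (i) $\dim V=4$ and $(\cos\Theta_{V,W})^{1/2}+(\cos\Theta^\perp_{V,W})^{1/2}\neq\cos\Delta\theta_{V,W}$; (ii) $\dim V>4$ and $(\cos\Theta_{V,W})^{1/2}+(\cos\Theta^\perp_{V,W})^{1/2}>\cos\Delta\theta_{V,W}$.
   Context: All dimensions are real. A complex structure on $X$ is an automorphism $J:X\to X$ with $J^2=-I$; it is compatible if $\langle Ju,Jv\rangle=\langle u,v\rangle$ for all $u,v\in X$. A real subspace $V\subset X$ becomes complex under $J$ if $J(V)=V$. Real subspaces $V,W\subset X$ are simultaneously complexifiable if there is some compatible complex structure $J$ making both complex, i.e. $J(V)=V$ and $J(W)=W$. Principal angles: for nonzero subspaces $V,W\subset X$, with $p=\dim V$, $q=\dim W$, $m=\min\{p,q\}$, there are orthonormal bases $(e_1,\dots,e_p)$ of $V$ and $(f_1,\dots,f_q)$ of $W$ and uniquely determined numbers $0\le\theta_1\le\dots\le\theta_m\le\frac{\pi}{2}$ (the principal angles) such that $\langle e_i,f_j\rangle=\delta_{ij}\cos\theta_i$ (equal to $0$ whenever $i\neq j$). Grassmann angle: for nonzero subspaces $V,W\subset X$ with principal angles $\theta_1,\dots,\theta_m$, the Grassmann angle $\Theta_{V,W}\in[0,\frac{\pi}{2}]$ of $V$ with $W$ is $\Theta_{V,W}=\arccos(\cos\theta_1\cdots\cos\theta_m)$ if $\dim V\le\dim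 W$, and $\Theta_{V,W}=\frac{\pi}{2}$ if $\dim V>\dim W$. Also $\Theta_{\{0\},\{0\}}=\Theta_{\{0\},V}=0$ and $\Theta_{V,\{0\}}=\frac{\pi}{2}$ for $V\ne\{0\}$. The complementary Grassmann angle is $\Theta^\perp_{V,W}=\Theta_{V,W^\perp}$. Angular range: for nonzero $V,W$, $\theta^{\min}_{V,W}\in[0,\frac{\pi}{2}]$ is the minimum of the angles $\theta_{v,w}=\arccos\frac{\langle v,w\rangle}{\|v\|\|w\|}$ over nonzero $v\in V$, $w\in W$; $\theta^{\max}_{V,W}\in[0,\frac{\pi}{2}]$ is $\max_{v\in V, v\ne0}\min_{w\in W,w\neq0}\theta_{v,w}$ (it equals the largest principal angle if $\dim V\le\dim W$, and $\frac{\pi}{2}$ otherwise); and $\Delta\theta_{V,W}=\theta^{\max}_{V,W}-\theta^{\min}_{V,W}\in[0,\frac{\pi}{2}]$. *)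

(* Defs.v *)
From HB Require Import structures.
From mathcomp Require Import all_boot all_order all_algebra.
From mathcomp Require Import sesquilinear.
From mathcomp Require Import all_classical all_reals all_analysis.

Set Implicit Arguments.
Unset Strict Implicit.
Unset Printing Implicit Defensive.

Import Order.TTheory GRing.Theory Num.Theory.

Local Open Scope classical_set_scope.
Local Open Scope ring_scope.

(* A finite-dimensional real inner product space is given by X : vectType R,
   with R : realType, and a symmetric positive definite bilinear form
   ip : {dot X for idfun}. *)

Section SimultaneousComplexification.
Context {R : realType} {X : vectType R}.
Variable ip : {dot X for idfun}.
Implicit Types V W : {vspace X}.

Definition complex_structure (J : 'End(X)) : Prop :=
  forall u, J (J u) = - u.

Definition compatible_complex_structure (J : 'End(X)) : Prop :=
  complex_structure J /\ isometry ip ip J.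

Definition simultaneously_complexifiable V W : Prop :=
  exists J : 'End(X), [/\ compatible_complex_structure J,
    (J @: V)%VS = V & (J @: W)%VS = W].

Definition vnorm (v : X) : R := Num.sqrt (ip v v).

Definition vangle (v w : X) : R := acos (ip v w / (vnorm v * vnorm w)).

(* In the matrix (ip e_i f_j) the equality i == j compares natural numbers;
   it forces i < minn (\dim V) (\dim W), so theta`_i is a true entry. *)
Definition is_principal_angles V W
    (theta : (minn (\dim V) (\dim W)).-tuple R) : Prop :=
  [/\ sorted <=%R theta,
      all (fun t => 0 <= t <= pi / 2) theta &
      exists (e : (\dim V).-tuple X) (f : (\dim W).-tuple X),
      [/\ basis_of V e && orthonormal ip e,
          basis_of W f && orthonormal ip f &
          forall (i : 'I_(\dim V)) (j : 'I_(\dim W)),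
            ip (tnth e i) (tnth f j) =
            if i == j :> nat then cos theta`_i else 0]].

(* Principal angles exist and are unique (singular value decomposition of the
   matrix of the orthogonal projection from V to W), so this choice is the list
   of principal angles and the default value is never used. *)
Definition principal_angles V W : (minn (\dim V) (\dim W)).-tuple R :=
  xget [tuple 0 | _ < minn (\dim V) (\dim W)]
       [set theta | is_principal_angles theta].

(* Asymmetric in V and W when their dimensions differ. *)
Definition grassmann_angle V W : R :=
  if V == 0%VS then 0
  else if W == 0%VS then pi / 2
  else if (\dim V <= \dim W)%N
       then acos (\prod_(t <- principal_angles V W) cos t)
       else pi / 2.

Definition complementary_grassmann_angle V W : R :=
  grassmann_angle V (orthov ip W).

Definition nonzero_vectors V : set X := [set v | v \in V /\ v != 0].

(* For nonzero V and W the extrema below are attained, by compactness of the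
   unit spheres, so inf and sup are a minimum and a maximum. *)
Definition theta_min V W : R :=
  inf [set vangle v w | v in nonzero_vectors V & w in nonzero_vectors W].

Definition theta_max V W : R :=
  sup [set inf [set vangle v w | w in nonzero_vectors W]
      | v in nonzero_vectors V].

Definition angular_range V W : R := theta_max V W - theta_min V W.

End SimultaneousComplexification.

(* Main.v *)
Require Import Defs.
From HB Require Import structures.
From mathcomp Require Import all_boot all_order all_algebra.
From mathcomp Require Import sesquilinear.
From mathcomp Require Import all_classical all_reals all_analysis.
From mathcomp Require Import ring lra.

Import Order.TTheory GRing.Theory Num.Theory.
Import numFieldNormedType.Exports.
Local Open Scope ring_scope.

(** Let J be a compatible complex structure preserving V and W, and consider on V
the form pip W u v = <P_W u, P_W v>, where P_W is the orthogonal projection onto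
W; it measures how much of a vector of V is seen by W.  Since J commutes with
P_W, it preserves this form, and both v, J v and P_W v, J P_W v are orthogonal
pairs.  So a vector v maximising |P_W v| on the unit sphere of V spans with J v
a plane on which the form is scalar, and the orthogonal complement of this plane
in V is again J-invariant and orthogonal to the plane for the form.  By induction
([complex_spectral]) V has an orthonormal basis v_1, J v_1, ..., v_n, J v_n
diagonalising the form, the value x_k at v_k being repeated at J v_k.  These
x_k in [0, 1] are the squared cosines of the principal angles, with zeros added
when dim V > dim W; thus each occurs twice.

The three angles of the theorem are functions of the x_k.  The Grassmann angle
satisfies cos Theta = sqrt (det G), where G is the matrix of the form in any
orthonormal basis of V ([cos_grassmann_angle]): both sides can be read off from
principal bases, and det G does not depend on the basis.  For the paired basis
det G is the square of the product of the x_k, so cos Theta is that product.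
The projection onto the complement of W gives the form <u, v> - pip W u v, hence
the complementary angle has cosine the product of the 1 - x_k.  Finally
theta_min and theta_max are the arccosines of the square roots of the largest
value A and of the smallest value B among the x_k, so that
cos (theta_max - theta_min) = sqrt (A B) + sqrt ((1 - A) (1 - B))
([cos_angular_range]).

Splitting off A and B from the two products ([complexifiable_angles]), the left
hand side of the theorem is sqrt (A B) p + sqrt ((1 - A) (1 - B)) q, with p and
q in [0, 1] coming from the other x_k.  If dim V = 4 there are no others,
p = q = 1, and equality holds; in general the left hand side is at most the
right hand side. *)

(** * Orthonormal bases and orthogonal projections *)

Section InnerProduct.
Local Set Implicit Arguments.
Local Unset Strict Implicit.
Context {R : realType} {X : vectType R} (ip : {dot X for idfun}).
Implicit Types (U V W : {vspace X}) (u v w x : X) (s e f : seq X).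

Lemma ipC u v : ip u v = ip v u.
Proof. by rewrite hermC /= expr0 mul1r. Qed.

(** Restating the linearity of the form for [ip] itself keeps the head
    symbol of the rewritten terms unchanged: the generic lemmas return them
    under a coercion to bilinear maps that later rewriting does not see
    through. *)
Lemma ipBl u v w : ip (u - v) w = ip u w - ip v w.
Proof. exact: linearBl. Qed.

Lemma ipDl u v w : ip (u + v) w = ip u w + ip v w.
Proof. exact: linearDl. Qed.

Lemma ipZl a u v : ip (a *: u) v = a * ip u v.
Proof. exact: linearZl_LR. Qed.

Lemma ipNl u v : ip (- u) v = - ip u v.
Proof. exact: linearNl. Qed.

Lemma ip0l u : ip 0 u = 0.
Proof. exact: linear0l. Qed.

Lemma ip_suml (I : Type) (r : seq I) (P : pred I) (F : I -> X) v :
  ip (\sum_(i <- r | P i) F i) v = \sum_(i <- r | P i) ip (F i) v.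
Proof. exact: linear_sumlz. Qed.

Lemma ipBr u v w : ip w (u - v) = ip w u - ip w v.
Proof. by rewrite ipC ipBl !(ipC w). Qed.

Lemma ipDr u v w : ip w (u + v) = ip w u + ip w v.
Proof. by rewrite ipC ipDl !(ipC w). Qed.

Lemma ipZr a u v : ip u (a *: v) = a * ip u v.
Proof. by rewrite ipC ipZl ipC. Qed.

Lemma ipNr u v : ip u (- v) = - ip u v.
Proof. by rewrite ipC ipNl ipC. Qed.

Lemma ip0r u : ip u 0 = 0.
Proof. by rewrite ipC ip0l. Qed.

Lemma ip_gt0 u : u != 0 -> 0 < ip u u.
Proof. exact: neq0_dnorm_gt0. Qed.

Lemma ip_ge0 u : 0 <= ip u u.
Proof. by have [->|/ip_gt0/ltW//] := eqVneq u 0; rewrite ip0l. Qed.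

Lemma ip_eq0 u : (ip u u == 0) = (u == 0).
Proof.
have [->|/ip_gt0/lt0r_neq0/negbTE//] := eqVneq u 0.
by rewrite ip0l eqxx.
Qed.

(** The squared norm of |v|^2 u - <u, v> v is
    |v|^2 (|u|^2 |v|^2 - <u, v>^2). *)
Lemma ip_cauchy_schwarz u v : ip u v ^+ 2 <= ip u u * ip v v.
Proof.
have [->|v0] := eqVneq v 0; first by rewrite !ip0r expr0n mulr0.
have v_gt0 := ip_gt0 v0.
have := ip_ge0 (ip v v *: u - ip u v *: v).
rewrite ipBl !ipBr !ipZl !ipZr /= (ipC v u).
set a := ip u u; set b := ip u v; set c := ip v v => h.
have {}h : 0 <= c * (a * c - b ^+ 2) by nra.
by rewrite pmulr_rge0 // subr_ge0 in h.
Qed.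

Definition onb V s : bool := basis_of V s && orthonormal ip s.

Lemma orthonormal_cons v s :
  orthonormal ip (v :: s) =
  [&& ip v v == 1, all (fun x => ip v x == 0) s & orthonormal ip s].
Proof.
rewrite /orthonormal /= !andbT.
by case: (_ == 1); case: (all _ _); case: (all _ _).
Qed.

Lemma orthonormal_nth s i j : orthonormal ip s ->
  (i < size s)%N -> (j < size s)%N -> ip s`_i s`_j = (i == j)%:R.
Proof.
elim: s i j => [|v s IHs] // i j.
rewrite orthonormal_cons => /and3P[/eqP vv /allP vs os].
case: i j => [|i] [|j] //= ilt jlt; rewrite ?ltnS in ilt jlt.
- by apply/eqP/vs/mem_nth.
- by rewrite ipC; apply/eqP/vs/mem_nth.
- by rewrite IHs // eqSS.
Qed.

Lemma onb_size V s : onb V s -> size s = \dim V.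
Proof. by case/andP=> ba _; rewrite (size_basis (X := in_tuple s) ba). Qed.

Lemma onb_mem V s x : onb V s -> x \in s -> x \in V.
Proof. by case/andP=> /basis_mem h _; apply: h. Qed.

Lemma onb_nth V s i : onb V s -> (i < \dim V)%N -> s`_i \in V.
Proof. by move=> bs il; rewrite (onb_mem bs) // mem_nth // (onb_size bs). Qed.

(** The coordinates of u in an orthonormal basis are its products with
    the basis vectors. *)
Lemma onb_expand V s u : onb V s -> u \in V -> u = \sum_(x <- s) ip u x *: x.
Proof.
move=> bs uV; have /andP[ba os] := bs.
have uE := coord_basis (X := in_tuple s) ba uV.
have cE (i : 'I_(size s)) : coord (in_tuple s) i u = ip u s`_i.
  rewrite [in RHS]uE ip_suml (bigD1 i) //= big1 => [|j ji].
    rewrite addr0 ipZl orthonormal_nth // eqxx.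
    by rewrite mulr1.
  rewrite ipZl orthonormal_nth //.
  by rewrite (negbTE (_ : val j != val i)) ?mulr0.
rewrite [LHS]uE (big_nth 0) big_mkord.
by apply: eq_bigr => i _; rewrite cE.
Qed.

Lemma ip_onb V s u w : onb V s -> u \in V ->
  ip u w = \sum_(x <- s) ip u x * ip x w.
Proof.
move=> bs uV; rewrite [in LHS](onb_expand bs uV) ip_suml.
by apply: eq_bigr => x _; rewrite ipZl.
Qed.

Definition perp V v : {vspace X} := (V :&: orthov ip <[v]>)%VS.

Lemma mem_perp V v u : (u \in perp V v) = (u \in V) && (ip v u == 0).
Proof. by rewrite memv_cap mem_orthov1 ipC. Qed.

Lemma ip_orthovP V u :
  reflect (forall v, v \in V -> ip u v = 0) (u \in orthov ip V).
Proof. exact: mem_orthovP. Qed.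

(** Removing a unit vector lowers the dimension by exactly one; together with
    [onb_cons] this drives the inductions on the dimension below. *)
Lemma dim_perp V v : v \in V -> ip v v = 1 -> \dim V = (\dim (perp V v)).+1.
Proof.
move=> vV vv; have V0 : (0 < \dim V)%N.
  rewrite lt0n dimv_eq0; apply: contraTneq vV => ->.
  rewrite memv0 -ip_eq0 vv; exact: oner_neq0.
rewrite -eq_dim_orthov1 ?prednK //; apply/negP => /ip_orthovP/(_ v vV)/eqP.
by rewrite vv oner_eq0.
Qed.

Lemma onb_cons V v s : v \in V -> ip v v = 1 -> onb (perp V v) s ->
  onb V (v :: s).
Proof.
move=> vV vv bs; have /andP[ba os] := bs.
apply/andP; split; last first.
  rewrite orthonormal_cons vv eqxx os andbT /=; apply/allP => x xs.
  by have := onb_mem bs xs; rewrite mem_perp => /andP[].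
rewrite basisEdim /= (onb_size bs) -dim_perp // leqnn andbT.
apply/subvP => u uV; rewrite span_cons.
rewrite -[u](subrK (ip v u *: v)) addrC memv_add ?memvZ ?memv_line //.
rewrite (span_basis ba) mem_perp rpredB ?memvZ //=.
by rewrite ipBr ipZr vv mulr1 subrr.
Qed.

Lemma unit_vector V : V != 0%VS -> exists2 v, v \in V & ip v v = 1.
Proof.
move=> V0; pose v := vpick V; have v0 : v != 0 by rewrite vpick0.
exists ((Num.sqrt (ip v v))^-1 *: v); first by rewrite memvZ // memv_pick.
rewrite ipZl ipZr mulrA -invfM -expr2 sqr_sqrtr ?ip_ge0 //.
by rewrite mulVf // ip_eq0.
Qed.

Lemma onb_exists V : exists s, onb V s.
Proof.
move: {2}(\dim V) (erefl (\dim V)) => n; elim: n V => [|n IHn] V dV.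
  exists [::]; rewrite /onb /orthonormal /= andbT.
  by rewrite basisEdim /= andbT (eqP (_ : V == 0%VS)) ?sub0v // -dimv_eq0 dV.
have V0 : V != 0%VS by rewrite -dimv_eq0 dV.
have [v vV vv] := unit_vector V0.
have [s bs] : exists s, onb (perp V v) s.
  by apply: IHn; apply/eqP; rewrite -eqSS -dim_perp // dV.
by exists (v :: s); apply: onb_cons.
Qed.

Lemma orthov_cap0 W : (W :&: orthov ip W = 0)%VS.
Proof.
apply/eqP; rewrite -subv0; apply/subvP => u; rewrite memv_cap memv0.
by case/andP=> uW /ip_orthovP/(_ _ uW) /eqP; rewrite ip_eq0.
Qed.

(** Every u splits as the sum of its Fourier expansion in an orthonormal
    basis of W and a vector orthogonal to W. *)
Lemma orthov_addT W : (W + orthov ip W)%VS = fullv.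
Proof.
apply/eqP; rewrite eqEsubv subvf; apply/subvP => u _.
have [s bs] := onb_exists W.
pose p := \sum_(x <- s) ip u x *: x.
have pW : p \in W.
  rewrite /p big_seq; apply: memv_suml => x xs.
  by rewrite memvZ // (onb_mem bs).
rewrite -[u](subrKC p) memv_add //; apply/ip_orthovP => y yW.
rewrite ipBl /p ip_suml [ip u y]ipC (ip_onb u bs yW).
rewrite -sumrB big1 // => x _.
by rewrite ipZl [ip x u]ipC [ip y x]ipC mulrC subrr.
Qed.

Definition oproj W : 'End(X) := daddv_pi W (orthov ip W).

Lemma oproj_mem W u : oproj W u \in W. Proof. exact: memv_pi. Qed.

Lemma oproj_perp W u y : y \in W -> ip (oproj W u) y = ip u y.
Proof.
move=> yW.
have /esym uE : oproj W u + daddv_pi (orthov ip W) W u = u.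
  by apply: daddv_pi_add; rewrite ?orthov_cap0 // orthov_addT memvf.
rewrite [in RHS]uE ipDl [X in _ + X](_ : _ = 0) ?addr0 //.
by have /ip_orthovP -> := memv_pi (orthov ip W) W u.
Qed.

(** If p and the projection of u have the same products with all of W,
    their difference lies in W and is orthogonal to W, hence vanishes. *)
Lemma oproj_unique W u p : p \in W -> (forall y, y \in W -> ip p y = ip u y) ->
  oproj W u = p.
Proof.
move=> pW pE; apply/eqP; rewrite -subr_eq0 -ip_eq0 ipBl.
have dW : oproj W u - p \in W by rewrite rpredB ?oproj_mem.
by rewrite oproj_perp // pE // subrr.
Qed.

(** The symmetric form on X given by the inner product of projections onto W.
    Restricted to V it carries all the metric information on the relative
    position of V and W. *)
Definition pip W u v : R := ip (oproj W u) (oproj W v).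

Lemma pipC W u v : pip W u v = pip W v u. Proof. exact: ipC. Qed.

(** The orthogonal projection is self-adjoint and idempotent, so one projection
    suffices. *)
Lemma pipE W u v : pip W u v = ip (oproj W u) v.
Proof. by rewrite /pip ipC oproj_perp ?oproj_mem // ipC. Qed.

Lemma pipDl W u v w : pip W (u + v) w = pip W u w + pip W v w.
Proof. by rewrite !pipE linearD ipDl. Qed.

Lemma pipZl W a u v : pip W (a *: u) v = a * pip W u v.
Proof. by rewrite !pipE linearZ ipZl. Qed.

Lemma pip_suml W (I : Type) (r : seq I) (P : pred I) (F : I -> X) v :
  pip W (\sum_(i <- r | P i) F i) v = \sum_(i <- r | P i) pip W (F i) v.
Proof. by rewrite pipE linear_sum ip_suml; under eq_bigr do rewrite -pipE. Qed.

Lemma pip_ge0 W u : 0 <= pip W u u. Proof. exact: ip_ge0. Qed.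

(** The projections onto W and onto its complement add up to the identity;
    the complementary angle is therefore governed by the same data. *)
Lemma oproj_orthov W u : oproj (orthov ip W) u = u - oproj W u.
Proof.
apply: oproj_unique => [|y /ip_orthovP yW].
  by apply/ip_orthovP => y yW; rewrite ipBl oproj_perp // subrr.
by rewrite ipBl [ip (oproj W u) y]ipC yW ?oproj_mem // subr0.
Qed.

Lemma pip_orthov W u v : pip (orthov ip W) u v = ip u v - pip W u v.
Proof. by rewrite pipE oproj_orthov ipBl -pipE. Qed.

Lemma pip_le W u : pip W u u <= ip u u.
Proof. by rewrite -subr_ge0 -pip_orthov pip_ge0. Qed.

End InnerProduct.

(** * Maximising the length of a projection *)
Section Maximizer.
Local Set Implicit Arguments.
Local Unset Strict Implicit.
Context {R : realType} {X : vectType R} (ip : {dot X for idfun}).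
Implicit Types (U V W : {vspace X}) (u v w x : X) (s e f : seq X).
Local Open Scope classical_set_scope.

Lemma quad_continuous n (c : 'I_n -> 'I_n -> R) :
  continuous (fun a : 'rV[R]_n => \sum_i \sum_j a 0 i * a 0 j * c i j).
Proof.
have addc : continuous (fun z : R * R => z.1 + z.2) by exact: add_continuous.
apply: (continuous_big addc) => i _; apply: (continuous_big addc) => j _ a.
apply: (@continuousM _ _ (fun b : 'rV[R]_n => b 0 i * b 0 j)
                       (fun=> c i j)); last exact: cst_continuous.
apply: (@continuousM _ _ (fun b : 'rV[R]_n => b 0 i) (fun b => b 0 j));
  exact: coord_continuous.
Qed.

(** Closed as a level set of a continuous quadratic form, and bounded since no
    coordinate exceeds 1 in absolute value. *)
Lemma sphere_compact n :
  compact [set a : 'rV[R]_n | \sum_i a 0 i ^+ 2 = 1].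
Proof.
apply: bounded_closed_compact.
- exists 1; split => // M M1 a /= a1.
  rewrite [leLHS]/Num.Def.normr/= mx_normrE.
  apply: bigmax_le => [|[i j] _ /=]; first exact/ltW/(lt_trans ltr01).
  apply: le_trans (ltW M1); rewrite (ord1 i).
  rewrite -(ler_pXn2r (n := 2)) ?nnegrE // expr1n real_normK ?num_real //.
  rewrite -a1 (bigD1 j) //= lerDl.
  by apply: sumr_ge0 => k _; exact: sqr_ge0.
- have diagE (a : 'rV[R]_n) :
      \sum_i \sum_j a 0 i * a 0 j * (i == j)%:R = \sum_i a 0 i ^+ 2.
    apply: eq_bigr => i _; rewrite (bigD1 i) //= eqxx mulr1.
    by rewrite big1 ?addr0 // => j ji; rewrite eq_sym (negbTE ji) mulr0.
  have /continuous_closedP : continuous (fun a : 'rV[R]_n =>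
      \sum_i \sum_j a 0 i * a 0 j * (i == j)%:R).
    exact: quad_continuous.
  move=> /(_ [set x | x = 1] (@closed_eq R 1)).
  rewrite (_ : _ @^-1` _ = [set a : 'rV[R]_n | \sum_i a 0 i ^+ 2 = 1]) //.
  by apply/seteqP; split => a /=; rewrite diagE.
Qed.

(** Compactness of the unit sphere is transported to V through the coordinates
    in an orthonormal basis; homogeneity then extends the bound from the sphere
    to all of V. This is the only place where the completeness of R enters the
    linear algebra. *)
Lemma pip_maximizer V W : V != 0%VS ->
  exists v, [/\ v \in V, ip v v = 1 &
    forall u, u \in V -> pip ip W u u <= pip ip W v v * ip u u].
Proof.
move=> V0; have [s bs] := onb_exists ip V.
pose n := size s; have os : orthonormal ip s by case/andP: bs.
pose vec (a : 'rV[R]_n) := \sum_i a 0 i *: s`_i.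
have vecV a : vec a \in V.
  by apply: memv_suml => i _; rewrite memvZ // (onb_mem bs) // mem_nth.
have qE a : pip ip W (vec a) (vec a) =
    \sum_i \sum_j a 0 i * a 0 j * pip ip W s`_i s`_j.
  rewrite {1}/vec pip_suml; apply: eq_bigr => i _.
  rewrite pipC pip_suml; apply: eq_bigr => j _.
  by rewrite pipZl pipC pipZl mulrCA mulrA.
have nE a : ip (vec a) (vec a) = \sum_i a 0 i ^+ 2.
  rewrite {1}/vec ip_suml; apply: eq_bigr => i _.
  rewrite ipZl ipC ip_suml (bigD1 i) //= ipZl orthonormal_nth // eqxx mulr1.
  rewrite big1 ?addr0 // => j ji; rewrite ipZl orthonormal_nth //.
  by rewrite (negbTE (_ : val j != val i)) ?mulr0.
have vec_onto u : u \in V -> exists a, vec a = u.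
  move=> uV; exists (\row_i ip u s`_i); rewrite [RHS](onb_expand bs uV).
  by rewrite (big_nth 0) big_mkord; apply: eq_bigr => i _; rewrite mxE.
have [v0 v0V v01] := unit_vector ip V0.
have [a0 a0E] := vec_onto _ v0V.
have [||c c1 cmax] := @compact_EVT_max _ R
    (fun a : 'rV[R]_n => pip ip W (vec a) (vec a))
    _ _ (sphere_compact (n := n)).
- by exists a0 => /=; rewrite -nE a0E.
- apply: continuous_subspaceT; rewrite (_ : (fun a => _) =
    (fun a : 'rV[R]_n => \sum_i \sum_j a 0 i * a 0 j * pip ip W s`_i s`_j)).
    exact: quad_continuous.
  by apply/funext => a; exact: qE.
exists (vec c); split => //; first by move: c1; rewrite inE /= -nE.
move=> u uV; have [->|u0] := eqVneq u 0.
  by rewrite pipE linear0 !ip0l mulr0.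
have u_gt0 := ip_gt0 ip u0; set r := Num.sqrt (ip u u).
have r2 : r ^+ 2 = ip u u by rewrite sqr_sqrtr // ltW.
have r0 : r != 0 by rewrite sqrtr_eq0 -ltNge.
(* Compare with the normalised vector u / |u|. *)
have [a aE] := vec_onto (r^-1 *: u) (memvZ _ uV).
have := cmax a; rewrite inE /= -nE aE.
rewrite pipZl pipC pipZl ipZl ipZr !mulrA -r2 -invfM -expr2.
rewrite mulVf ?expf_neq0 //.
by move=> /(_ erefl); rewrite ler_pdivrMl ?exprn_even_gt0 // mulrC.
Qed.

(** A maximiser of the Rayleigh quotient is an eigenvector: perturbing v by t u
    gives 2 t g <= t^2 K for all t, with g the value of the form at (v, u), and
    a small t of the sign of g violates this unless g = 0. *)
Lemma pip_critical V W v : v \in V -> ip v v = 1 ->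
  (forall u, u \in V -> pip ip W u u <= pip ip W v v * ip u u) ->
  forall u, u \in V -> ip v u = 0 -> pip ip W v u = 0.
Proof.
move=> vV vv vmax u uV vu.
set m := pip ip W v v; set g := pip ip W v u.
set K := m * ip u u - pip ip W u u.
have K0 : 0 <= K by rewrite subr_ge0 vmax.
have le_t t : 2 * t * g <= t ^+ 2 * K.
  have := vmax (v + t *: u) (memvD vV (memvZ t uV)).
  rewrite pipDl pipZl !(pipC _ _ _ (v + _)) !pipDl !pipZl.
  rewrite ipDl ipZl !ipDr !ipZr.
  rewrite (ipC _ u v) vu vv (pipC _ _ u v) -/m -/g /K; nra.
(* Any t = g / L with L > K / 2 is small enough; K + 1 is also nonzero. *)
have := le_t (g / (K + 1)).
have K1 : K + 1 != 0 by rewrite gt_eqF // ltr_wpDl.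
rewrite (_ : 2 * _ * g = 2 * (K + 1) * (g / (K + 1)) ^+ 2); last by field.
set z := g / (K + 1) => hz.
have z0 : z = 0.
  apply/eqP; rewrite -sqrf_eq0 eq_le sqr_ge0 andbT.
  have := sqr_ge0 z; nra.
by move/eqP: z0; rewrite mulf_eq0 invr_eq0 (negbTE K1) orbF => /eqP.
Qed.

End Maximizer.

(** * Diagonalising the projection form *)
Section Spectral.
Local Set Implicit Arguments.
Local Unset Strict Implicit.
Context {R : realType} {X : vectType R} (ip : {dot X for idfun}).
Implicit Types (U V W : {vspace X}) (u v w x : X) (s e f : seq X).

Definition pip_gram W n s : 'M[R]_n :=
  \matrix_(i < n, j < n) pip ip W s`_i s`_j.

Definition pip_diagonal W s := pairwise (fun x y => pip ip W x y == 0) s.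

Lemma det_pip_gram_diag W n s : size s = n -> pip_diagonal W s ->
  \det (pip_gram W n s) = \prod_(x <- s) pip ip W x x.
Proof.
move=> <- /(pairwiseP 0) ds.
rewrite (_ : pip_gram _ _ _ = diag_mx (\row_(i < size s) pip ip W s`_i s`_i)).
  rewrite det_diag [RHS](big_nth 0) big_mkord.
  by apply: eq_bigr => i _; rewrite mxE.
apply/matrixP => i j; rewrite !mxE; have [->|] := eqVneq i j => //.
rewrite -val_eqE /= neq_ltn => /orP[] ij; last rewrite pipC.
  all: by apply/eqP; apply: ds; rewrite ?inE.
Qed.

(** Two orthonormal bases differ by an orthogonal matrix O, and
    det (O G O^T) = det G since det (O O^T) = 1. *)
Lemma det_pip_gram_onb V W s s' : onb ip V s -> onb ip V s' ->
  \det (pip_gram W (\dim V) s) = \det (pip_gram W (\dim V) s').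
Proof.
move=> bs bs'; set n := \dim V.
have sz := onb_size bs; have sz' := onb_size bs'.
have sV i : (i < n)%N -> s`_i \in V by move=> ilt; apply: onb_nth bs ilt.
pose O := \matrix_(i < n, j < n) ip s`_i s'`_j.
have OO : O *m O^T = 1%:M.
  apply/matrixP => i k; rewrite !mxE.
  have /andP[_ os] := bs; rewrite -val_eqE /=.
  rewrite -(orthonormal_nth os) ?sz //.
  rewrite (ip_onb _ bs') ?sV // (big_nth 0) big_mkord sz'.
  by apply: eq_bigr => j _; rewrite !mxE (ipC _ s'`_j).
have -> : pip_gram W n s = O *m pip_gram W n s' *m O^T.
  apply/matrixP => i k; rewrite !mxE.
  rewrite (onb_expand bs' (sV k (ltn_ord k))) pipC pip_suml.
  rewrite (big_nth 0) big_mkord sz'.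
  apply: eq_bigr => l _; rewrite pipZl mulrC !mxE; congr (_ * _).
  rewrite pipC [s`_i](onb_expand bs' (sV i (ltn_ord i))) pip_suml.
  rewrite (big_nth 0) big_mkord sz'.
  by apply: eq_bigr => j _; rewrite pipZl !mxE.
by rewrite !det_mulmx mulrAC -det_mulmx OO det1 mul1r.
Qed.

(** The Gram matrix factors through the coordinates in W, so its rank is at
    most dim W. *)
Lemma det_pip_gram_lt V W s : onb ip V s -> (\dim W < \dim V)%N ->
  \det (pip_gram W (\dim V) s) = 0.
Proof.
move=> bs ltWV; have [f bf] := onb_exists ip W; have sz := onb_size bf.
pose G := \matrix_(i < \dim V, j < \dim W) ip s`_i f`_j.
have -> : pip_gram W (\dim V) s = G *m G^T.
  apply/matrixP => i k; rewrite !mxE pipE (ip_onb _ bf) ?oproj_mem //.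
  rewrite (big_nth 0) big_mkord sz; apply: eq_bigr => j _.
  rewrite !mxE (ipC _ f`_j) oproj_perp //.
  by rewrite (onb_mem bf) // mem_nth // sz.
apply/eqP; apply: contraTT ltWV.
rewrite -unitfE -unitmxE -row_free_unit -leqNgt => /eqP <-.
by rewrite (leq_trans (mxrankM_maxl _ _)) // rank_leq_col.
Qed.

Lemma pip_diag_expand V W e v : onb ip V e -> pip_diagonal W e -> v \in V ->
  pip ip W v v = \sum_(x <- e) ip v x ^+ 2 * pip ip W x x.
Proof.
move=> be /(pairwiseP 0) de vV.
have vE (i : 'I_(size e)) : pip ip W v e`_i = ip v e`_i * pip ip W e`_i e`_i.
  rewrite {1}(onb_expand be vV) pip_suml (big_nth 0) big_mkord (bigD1 i) //=.
  rewrite big1 => [|j]; first by rewrite addr0 pipZl.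
  rewrite pipZl -val_eqE /= neq_ltn => /orP[] ij; [|rewrite pipC];
    by rewrite (eqP (de _ _ _ _ ij)) ?mulr0 ?inE.
rewrite {1}(onb_expand be vV) pip_suml (big_nth 0) big_mkord.
rewrite [RHS](big_nth 0) big_mkord; apply: eq_bigr => i _.
by rewrite pipZl pipC vE mulrA -expr2.
Qed.

Section J.
Variable J : 'End(X).
Hypothesis J2 : complex_structure J.
Hypothesis Jiso : isometry ip ip J.

Lemma ipJ u v : ip (J u) (J v) = ip u v.
Proof. exact: Jiso. Qed.

(** By J^2 = -1 and isometry, <u, J u> = <J u, J J u> = - <u, J u>. *)
Lemma ip_J_eq0 u : ip u (J u) = 0.
Proof.
have h : ip u (J u) = - ip u (J u).
  by rewrite -{1}ipJ J2 ipNr ipC.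
lra.
Qed.

Lemma ipJl u v : ip (J u) v = - ip u (J v).
Proof. by rewrite -ipJ J2 ipNl. Qed.

(** J is invertible with inverse - J, so being mapped into V already gives
    equality. *)
Lemma J_stable V : (forall u, u \in V -> J u \in V) -> (J @: V)%VS = V.
Proof.
move=> h; apply/eqP; rewrite eqEsubv; apply/andP; split.
  by apply/subvP => _ /memv_imgP[u uV ->]; apply: h.
apply/subvP => u uV; have -> : u = J (- J u) by rewrite linearN /= J2 opprK.
by rewrite memv_img // rpredN h.
Qed.

Lemma J_mem V u : (J @: V)%VS = V -> u \in V -> J u \in V.
Proof. by move=> {2}<- uV; rewrite memv_img. Qed.

Lemma J_orthov W : (J @: W)%VS = W -> (J @: orthov ip W)%VS = orthov ip W.
Proof.
move=> JW; apply: J_stable => u /ip_orthovP uW; apply/ip_orthovP => v vW.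
by rewrite ipJl uW ?oppr0 // J_mem.
Qed.

(** J permutes W and its complement, hence commutes with the projection. *)
Lemma oproj_J W u : (J @: W)%VS = W -> oproj ip W (J u) = J (oproj ip W u).
Proof.
move=> JW; apply: oproj_unique => [|y yW]; first by rewrite J_mem ?oproj_mem.
by rewrite !ipJl oproj_perp // J_mem.
Qed.

Lemma pipJ W u v : (J @: W)%VS = W -> pip ip W (J u) (J v) = pip ip W u v.
Proof. by move=> JW; rewrite /pip !oproj_J // ipJ. Qed.

Lemma pip_J_eq0 W u : (J @: W)%VS = W -> pip ip W u (J u) = 0.
Proof. by move=> JW; rewrite /pip oproj_J // ip_J_eq0. Qed.

(** The paired list v_1, J v_1, v_2, J v_2, ...; keeping each v next to its
    image lets bases grow by two applications of [onb_cons]. *)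
Definition with_J vs : seq X := flatten [seq [:: v; J v] | v <- vs].

Lemma prod_with_J W vs : (J @: W)%VS = W ->
  \prod_(x <- with_J vs) pip ip W x x = (\prod_(v <- vs) pip ip W v v) ^+ 2.
Proof.
move=> JW; rewrite big_flatten big_map -prodrXl; apply: eq_bigr => v _.
by rewrite !big_cons big_nil /= mulr1 pipJ.
Qed.

(** Spectral theorem for a form commuting with J. A maximiser v of the
    form splits off the plane spanned by v and J v, on which the form is scalar.
    The complement of this plane in V is J-invariant, and by criticality of v it
    is orthogonal to the plane for the form as well; the induction continues
    there. Taking maximisers yields decreasing eigenvalues. *)
Lemma complex_spectral V W : (J @: V)%VS = V -> (J @: W)%VS = W ->
  exists vs, [/\ onb ip V (with_J vs), pip_diagonal W (with_J vs) &
    sorted (fun u v => pip ip W v v <= pip ip W u u) vs].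
Proof.
move=> + JW; move: {2}(\dim V) (leqnn (\dim V)) => n.
elim: n V => [|n IHn] V dV JV.
  have V0 : V = 0%VS by apply/eqP; rewrite -dimv_eq0 -leqn0.
  exists [::]; split=> //; have [s bs] := onb_exists ip V.
  have s0 : s = [::] by apply: size0nil; rewrite (onb_size bs) V0 dimv0.
  by rewrite s0 in bs.
have [V0|V0] := eqVneq V 0%VS; first by apply: IHn; rewrite // V0 dimv0.
have [v [vV v1 vmax]] := pip_maximizer ip W V0.
have crit := pip_critical vV v1 vmax.
pose V1 := perp ip V v; pose V2 := perp ip V1 (J v).
have JvV1 : J v \in V1 by rewrite mem_perp J_mem // ip_J_eq0 eqxx.
have Jv1 : ip (J v) (J v) = 1 by rewrite ipJ.
have JV2 : (J @: V2)%VS = V2.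
  apply: J_stable => u; rewrite !mem_perp => /andP[/andP[uV /eqP vu] /eqP Jvu].
  have h : ip v (J u) = 0 by move: Jvu; rewrite ipJl; lra.
  by rewrite J_mem // h ipJ vu !eqxx.
have [|vs [bvs dvs svs]] := IHn V2 _ JV2.
  rewrite -ltnS (leq_trans _ dV) // (dim_perp vV v1) ltnS.
  by rewrite (dim_perp JvV1 Jv1) leqW.
have vsV2 x : x \in with_J vs -> x \in V2 by exact: onb_mem bvs.
exists (v :: vs); split.
- exact/onb_cons/onb_cons.
- rewrite /pip_diagonal /= pip_J_eq0 // eqxx /= -/(with_J vs).
  apply/and3P; split; last exact: dvs.
    apply/allP => x /vsV2; rewrite !mem_perp => /andP[/andP[xV /eqP vx] _].
    by rewrite crit.
  apply/allP => x /vsV2; rewrite !mem_perp => /andP[/andP[xV vx] /eqP Jvx].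
  have h : pip ip W (J v) x = - pip ip W v (J x).
    by rewrite -(pipJ _ _ JW) J2 !pipE linearN ipNl -!pipE.
  by rewrite h crit ?oppr0 // ?J_mem //; move: Jvx; rewrite ipJl; lra.
- case: vs bvs dvs svs vsV2 => //= w vs bvs _ -> vsV2; rewrite andbT.
  have wV2 : w \in V2 by apply: vsV2; rewrite mem_head.
  have w1 : ip w w = 1.
    have /andP[_] := bvs; rewrite orthonormal_cons => /and3P[/eqP //].
  move: wV2; rewrite !mem_perp => /andP[/andP[wV _] _].
  by have := vmax w wV; rewrite w1 mulr1.
Qed.

End J.
End Spectral.

(** * Principal angles and the Grassmann angle *)
Lemma ge1_le1 (R : realType) (x : R) : 0 <= x <= 1 -> -1 <= x <= 1.
Proof. by case/andP=> x0 ->; rewrite (le_trans _ x0) // lerN10. Qed.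

Lemma ler_acos (R : realType) (x y : R) :
  -1 <= x <= 1 -> -1 <= y <= 1 -> x <= y -> acos y <= acos x.
Proof.
move=> x1 y1 xy; rewrite leNgt; apply/negP.
rewrite -ltr_cos ?in_itv /= ?acos_ge0 ?acos_lepi // !acosK ?in_itv //=.
by rewrite ltNge xy.
Qed.

Lemma acos_pihalf (R : realType) (x : R) : 0 <= x <= 1 -> 0 <= acos x <= pi / 2.
Proof.
move=> x1; have x11 := ge1_le1 _ _ x1; rewrite acos_ge0 //= -acos0.
by apply: ler_acos; rewrite // ?lerN10 ?ler01 //; case/andP: x1.
Qed.

Lemma ler_sqrt_of_sqr (R : realType) (x y : R) :
  x ^+ 2 <= y -> `|x| <= Num.sqrt y.
Proof. by move=> /ler_wsqrtr; rewrite sqrtr_sqr. Qed.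

Section PrincipalAngles.
Local Set Implicit Arguments.
Local Unset Strict Implicit.
Context {R : realType} {X : vectType R} (ip : {dot X for idfun}).
Implicit Types (U V W : {vspace X}) (u v w x : X) (s e f : seq X).

(** Polar form of the projection of v. When this projection
    vanishes any unit vector of W serves, which spares a case distinction on
    singular values equal to zero. *)
Lemma exists_image_direction W v : W != 0%VS ->
  exists2 w, w \in W /\ ip w w = 1 &
    oproj ip W v = Num.sqrt (pip ip W v v) *: w.
Proof.
move=> W0; have [p0|p0] := eqVneq (oproj ip W v) 0.
  have [w wW w1] := unit_vector ip W0; exists w => //.
  by rewrite /pip p0 ip0l sqrtr0 scale0r.
set c := Num.sqrt _; have c0 : c != 0 by rewrite sqrtr_eq0 -ltNge ip_gt0.
have c2 : c ^+ 2 = pip ip W v v by rewrite sqr_sqrtr // pip_ge0.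
exists (c^-1 *: oproj ip W v); last by rewrite scalerA mulfV // scale1r.
split; first by rewrite memvZ // oproj_mem.
rewrite ipZl ipZr mulrA -invfM -/(pip ip W v v) -c2 -expr2.
by rewrite mulVf // expf_neq0.
Qed.

(** Singular value decomposition of the projection from V to W, by induction on
    dim V: if v maximises |P_W v| over unit vectors and w is the direction of
    P_W v, then w is orthogonal to the complement of v in V (criticality) and v
    is orthogonal to the complement of w in W, so both vectors can be split off.
    The next cosine is a value of <u, y> on unit vectors, at most |P_W u| by
    Cauchy-Schwarz, hence at most the current one. *)
Lemma svd V W : (\dim V <= \dim W)%N ->
  exists e f (c : seq R), [/\ onb ip V e, onb ip W f,
    (forall i j, (i < \dim V)%N -> (j < \dim W)%N ->
      ip e`_i f`_j = if i == j then c`_i else 0),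
    size c = \dim V &
    all (fun t => 0 <= t <= 1) c && sorted (fun a b : R => b <= a) c].
Proof.
move: {2}(\dim V) (erefl (\dim V)) => n.
elim: n V W => [|n IHn] V W dV dVW.
  have [e be] := onb_exists ip V; have [f bf] := onb_exists ip W.
  by exists e, f, [::]; split=> //; rewrite dV.
have V0 : V != 0%VS by rewrite -dimv_eq0 dV.
have W0 : W != 0%VS by rewrite -dimv_eq0 -lt0n (leq_trans _ dVW) // dV.
have [v [vV v1 vmax]] := pip_maximizer ip W V0.
have crit := pip_critical vV v1 vmax.
have [w [wW w1]] := exists_image_direction v W0.
set c0 := Num.sqrt _ => pE.
have c0_ge0 : 0 <= c0 by exact: sqrtr_ge0.
have c02 : c0 ^+ 2 = pip ip W v v by rewrite sqr_sqrtr // pip_ge0.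
have c0_le1 : c0 <= 1.
  by rewrite -(ler_pXn2r (n := 2)) ?nnegrE // expr1n c02 -v1 pip_le.
have dVv := dim_perp vV v1; have dWw := dim_perp wW w1.
have [||e [f [c [be bf ef sc /andP[c01 cs]]]]] :=
    IHn (perp ip V v) (perp ip W w).
- by apply/eqP; rewrite -eqSS -dVv dV.
- by rewrite -ltnS -dVv -dWw.
exists (v :: e), (w :: f), (c0 :: c); split.
- exact: onb_cons.
- exact: onb_cons.
- have vw' y : y \in W -> ip v y = c0 * ip w y.
    by move=> yW; rewrite -(oproj_perp _ v yW) pE ipZl.
  (* If c0 = 0, maximality forces the projection of V onto W to vanish;
     otherwise w is proportional to the projection of v, and v is critical. *)
  have ew u : u \in perp ip V v -> ip u w = 0.
    rewrite mem_perp => /andP[uV /eqP vu]; have [c00|c0n] := eqVneq c0 0.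
      have pu0 : pip ip W u u <= 0.
        by have := vmax u uV; rewrite -c02 c00 expr0n mul0r.
      have := ip_cauchy_schwarz ip (oproj ip W u) w.
      rewrite oproj_perp // w1 mulr1 => /le_trans/(_ pu0) h.
      by apply/eqP; rewrite -sqrf_eq0 eq_le h sqr_ge0.
    have : c0 * ip u w = 0 by rewrite -ipZr -pE ipC -pipE crit.
    by move/eqP; rewrite mulf_eq0 (negbTE c0n) => /eqP.
  rewrite dVv dWw => -[|i] [|j] //= ilt jlt.
  + by rewrite vw' // w1 mulr1.
  + have := onb_nth bf jlt; rewrite mem_perp => /andP[fW /eqP wf].
    by rewrite vw' // wf mulr0.
  + by rewrite ew // (onb_nth be).
  + by rewrite ef // eqSS.
- by rewrite /= sc dVv.
- rewrite /= c0_ge0 c0_le1 c01 /=.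
  case: c sc c01 cs ef => //= c1 c sc /andP[/andP[c1_ge0 _] _] -> ef.
  rewrite andbT -(ler_pXn2r (n := 2)) ?nnegrE // c02.
  have dV'0 : (0 < \dim (perp ip V v))%N by rewrite -sc.
  have dW'0 : (0 < \dim (perp ip W w))%N.
    by rewrite (leq_trans dV'0) // -ltnS -dVv -dWw.
  have := ef 0 0 dV'0 dW'0; rewrite /= => <-.
  have eV : e`_0 \in V.
    by have := onb_nth be dV'0; rewrite mem_perp => /andP[].
  have fW : f`_0 \in W.
    by have := onb_nth bf dW'0; rewrite mem_perp => /andP[].
  rewrite -(oproj_perp _ _ fW).
  apply: le_trans (ip_cauchy_schwarz _ _ _) _.
  have /andP[_ oe] := be; have /andP[_ of_] := bf.
  rewrite (orthonormal_nth of_) ?(onb_size bf) // mulr1.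
  by have := vmax _ eV; rewrite (orthonormal_nth oe) ?(onb_size be) // mulr1.
Qed.

Lemma principal_angles_exist V W : (\dim V <= \dim W)%N ->
  exists theta, @is_principal_angles R X ip V W theta.
Proof.
move=> dVW; have [e [f [c [be bf ef sc /andP[/allP c01 cs]]]]] := svd dVW.
have [se sf] := (onb_size be, onb_size bf).
have st : size (map acos c) == minn (\dim V) (\dim W).
  by rewrite size_map sc (minn_idPl dVW).
exists (Tuple st); split => /=.
- apply: (homo_sorted_in (P := [pred x | -1 <= x <= 1]) _ _ cs).
    by move=> x y; rewrite !inE => x1 y1; apply: ler_acos.
  by apply/allP => x /c01 /ge1_le1.
- by apply/allP => _ /mapP[x /c01 x01 ->]; apply: acos_pihalf.
- have se' : size e == \dim V by rewrite se.
  have sf' : size f == \dim W by rewrite sf.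
  exists (Tuple se'), (Tuple sf'); split => //= i j.
  rewrite !(tnth_nth 0) /= ef //; case: eqP => // _.
  rewrite (nth_map 0) ?sc // acosK // in_itv /= ge1_le1 //.
  by apply/c01/mem_nth; rewrite sc.
Qed.

(** In principal bases the projection of e_i is cos theta_i f_i, so the
    Gram matrix is diagonal with entries cos^2 theta_i; by basis independence
    its determinant is the squared product of cosines for every orthonormal
    basis. If dim V > dim W, both sides are zero because the Gram matrix is
    singular. *)
Lemma cos_grassmann_angle V W s : V != 0%VS -> onb ip V s ->
  cos (grassmann_angle ip V W) = Num.sqrt (\det (pip_gram ip W (\dim V) s)).
Proof.
move=> V0 bs; rewrite /grassmann_angle (negbTE V0).
have [dVW|dVW] := boolP (\dim V <= \dim W)%N; last first.
  by rewrite if_same cos_pihalf (det_pip_gram_lt bs) ?sqrtr0 // ltnNge.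
have W0 : W != 0%VS.
  by rewrite -dimv_eq0 -lt0n (leq_trans _ dVW) // lt0n dimv_eq0.
rewrite (negbTE W0).
have pa : is_principal_angles ip (principal_angles ip V W).
  exact: xgetPex (principal_angles_exist dVW).

move: (principal_angles ip V W) pa => theta [_ /allP t01 [e [f [be bf ef]]]].
have be' : onb ip V e by [].
have bf' : onb ip W f by [].
have se := onb_size be'; have sf := onb_size bf'.
have st : size theta = \dim V by rewrite size_tuple (minn_idPl dVW).
have ct i : (i < \dim V)%N -> 0 <= cos theta`_i <= 1.
  move=> il; rewrite cos_le1 andbT cos_ge0_pihalf //.
  have /andP[h ->] := t01 theta`_i (mem_nth 0 (etrans (congr1 _ st) il)).
  by rewrite andbT (le_trans _ h) // oppr_le0 divr_ge0 // pi_ge0.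
have prodE : \prod_(t <- theta) cos t = \prod_(i < \dim V) cos theta`_i.
  by rewrite (big_nth 0) big_mkord st.
have prod01 : 0 <= \prod_(t <- theta) cos t <= 1.
  rewrite prodE prodr_ge0 /= => [|i _]; last by case/andP: (ct i (ltn_ord i)).
  by apply: prodr_ile1 => i _; exact: ct.
rewrite acosK ?in_itv /= ?ge1_le1 //.
rewrite (det_pip_gram_onb W bs be').
have pE (i : 'I_(\dim V)) : oproj ip W e`_i = cos theta`_i *: f`_i.
  have ilt : (i < \dim W)%N by exact: leq_trans (ltn_ord i) dVW.
  have fW : f`_i \in W by exact: onb_nth bf' ilt.
  apply: oproj_unique => [|y yW]; first by rewrite memvZ.
  rewrite ipZl ipC [RHS]ipC (ip_onb e`_i bf' yW) (big_nth 0) big_mkord sf.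
  have fe (j : 'I_(\dim W)) : ip f`_j e`_i =
      if i == j :> nat then cos theta`_i else 0.
    by rewrite ipC -ef !(tnth_nth 0).
  rewrite (bigD1 (Ordinal ilt)) //= big1 => [|j ji]; last first.
    by rewrite fe ifN ?mulr0 // eq_sym; move: ji; rewrite -val_eqE.
  by rewrite (fe (Ordinal ilt)) /= eqxx addr0 mulrC.
have -> : pip_gram ip W (\dim V) e =
    diag_mx (\row_(i < \dim V) cos theta`_i ^+ 2).
  apply/matrixP => i j; rewrite !mxE /pip !pE ipZl ipZr.
  have /andP[_ of_] := bf'.
  rewrite orthonormal_nth // ?sf ?(leq_trans (ltn_ord _) dVW) // -val_eqE /=.
  by case: eqP => [->|_]; rewrite ?mulr1 ?mulr0 // -expr2.
rewrite det_diag prodE.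
under [in RHS]eq_bigr do rewrite mxE.
rewrite prodrXl sqrtr_sqr ger0_norm //.
by rewrite -prodE; case/andP: prod01.
Qed.
End PrincipalAngles.

(** * Angular range and invariant pairs *)
Section AngularRange.
Local Set Implicit Arguments.
Local Unset Strict Implicit.
Context {R : realType} {X : vectType R} (ip : {dot X for idfun}).
Implicit Types (U V W : {vspace X}) (u v w x : X) (s e f : seq X).
Local Open Scope classical_set_scope.

Lemma inf_attained (A : set R) m : A m -> lbound A m -> inf A = m.
Proof.
by move=> Am lbm; apply/eqP; rewrite eq_le ge_inf ?lb_le_inf //; exists m.
Qed.

Lemma sup_attained (A : set R) m : A m -> ubound A m -> sup A = m.
Proof.
by move=> Am ubm; apply/eqP; rewrite eq_le ub_le_sup ?ge_sup //; exists m.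
Qed.

(** The cosine of the angle between v and W, namely |P_W v| / |v|. *)
Definition proj_cos W v : R := Num.sqrt (pip ip W v v / ip v v).

Lemma proj_cos01 W v : 0 <= proj_cos W v <= 1.
Proof.
rewrite sqrtr_ge0 /= -[leRHS]sqrtr1 ler_wsqrtr //.
have [->|v0] := eqVneq v 0; first by rewrite ip0l invr0 mulr0.
by rewrite ler_pdivrMr ?mul1r ?pip_le // ip_gt0.
Qed.

(** For w in W, <v, w> = <P_W v, w>, so this is Cauchy-Schwarz. *)
Lemma cos_vangle_le W v w : w \in W -> v != 0 -> w != 0 ->
  `|ip v w / (vnorm ip v * vnorm ip w)| <= proj_cos W v.
Proof.
move=> wW v0 w0; apply: ler_sqrt_of_sqr.
have [v_gt0 w_gt0] := (ip_gt0 ip v0, ip_gt0 ip w0).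
rewrite expr_div_n exprMn !sqr_sqrtr ?ip_ge0 //.
rewrite ler_pdivrMr ?mulr_gt0 // mulrA divfK ?gt_eqF //.
by rewrite -(oproj_perp _ v wW); exact: ip_cauchy_schwarz.
Qed.

(** The best approximation of the direction of v inside W is the direction
    of its projection. *)
Lemma cos_vangle_attained W v : W != 0%VS -> exists2 w, nonzero_vectors W w &
  ip v w / (vnorm ip v * vnorm ip w) = proj_cos W v.
Proof.
move=> W0; have [w [wW w1] pE] := exists_image_direction ip v W0.
exists w; first by split; rewrite // -(ip_eq0 ip) w1 oner_neq0.
rewrite /proj_cos -(oproj_perp _ v wW) pE ipZl w1 /vnorm w1 sqrtr1 !mulr1.
by rewrite sqrtrM ?pip_ge0 // sqrtrV ?ip_ge0.
Qed.

Lemma acos_proj_cos_le W v w : w \in W -> v != 0 -> w != 0 ->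
  acos (proj_cos W v) <= vangle ip v w.
Proof.
move=> wW v0 w0; have := cos_vangle_le wW v0 w0; have c01 := proj_cos01 W v.
rewrite ler_norml => /andP[h1 h2]; apply: ler_acos => //; last exact: ge1_le1.
by case/andP: c01 => _ c1; rewrite (le_trans h2) // (le_trans _ h1) // lerN2.
Qed.

Lemma inf_vangle W v : W != 0%VS -> v != 0 ->
  inf [set vangle ip v w | w in nonzero_vectors W] = acos (proj_cos W v).
Proof.
move=> W0 v0; apply: inf_attained.
  have [w Ww wE] := cos_vangle_attained v W0.
  by exists w; rewrite // /vangle wE.
by move=> _ [w [wW w0] <-]; exact: acos_proj_cos_le.
Qed.

Lemma theta_minE V W a : W != 0%VS -> nonzero_vectors V a ->
  (forall v, nonzero_vectors V v -> proj_cos W v <= proj_cos W a) ->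
  theta_min ip V W = acos (proj_cos W a).
Proof.
move=> W0 Va amax; apply: inf_attained.
  have [w Ww wE] := cos_vangle_attained a W0.
  by exists a => //; exists w; rewrite // /vangle wE.
move=> _ [v Vv [w [wW w0] <-]]; have [_ v0] := Vv.
apply: le_trans (acos_proj_cos_le wW v0 w0).
by apply: ler_acos; rewrite ?ge1_le1 ?proj_cos01 ?amax.
Qed.

Lemma theta_maxE V W b : W != 0%VS -> nonzero_vectors V b ->
  (forall v, nonzero_vectors V v -> proj_cos W b <= proj_cos W v) ->
  theta_max ip V W = acos (proj_cos W b).
Proof.
move=> W0 Vb bmin; apply: sup_attained.
  by exists b => //; rewrite inf_vangle //; case: Vb.
move=> _ [v Vv <-]; rewrite inf_vangle //; last by case: Vv.
by apply: ler_acos; rewrite ?ge1_le1 ?proj_cos01 ?bmin.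
Qed.

(** The angle from v to W is acos (proj_cos W v) and acos is decreasing:
    theta_min comes from a vector a maximising this cosine and theta_max from a
    vector b minimising it. *)
Lemma cos_angular_range V W a b : W != 0%VS ->
  nonzero_vectors V a -> nonzero_vectors V b ->
  (forall v, nonzero_vectors V v ->
    proj_cos W b <= proj_cos W v <= proj_cos W a) ->
  cos (angular_range ip V W) = proj_cos W b * proj_cos W a +
    Num.sqrt (1 - proj_cos W b ^+ 2) * Num.sqrt (1 - proj_cos W a ^+ 2).
Proof.
move=> W0 Va Vb ab.
rewrite /angular_range (theta_minE W0 Va) ?(theta_maxE W0 Vb).
- have h v := ge1_le1 _ _ (proj_cos01 W v).
  by rewrite cosB !acosK ?in_itv /= ?h // !sin_acos.
- by move=> v /ab /andP[].
- by move=> v /ab /andP[].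
Qed.

Lemma orthonormal_pairwise s : orthonormal ip s ->
  pairwise (fun x y => ip x y == 0) s.
Proof.
move=> os; apply/(pairwiseP 0) => i j; rewrite !inE => il jl ij.
by rewrite orthonormal_nth // ltn_eqF.
Qed.

Lemma pip_diagonal_orthov W s : orthonormal ip s -> pip_diagonal ip W s ->
  pip_diagonal ip (orthov ip W) s.
Proof.
move=> /orthonormal_pairwise os ds.
have : pairwise (fun x y => (ip x y == 0) && (pip ip W x y == 0)) s.
  by rewrite pairwise_relI os.
apply: sub_pairwise => x y /andP[/eqP xy /eqP gxy].
by rewrite pip_orthov xy gxy subr0.
Qed.

Section J.
Variable J : 'End(X).
Hypothesis J2 : complex_structure J.
Hypothesis Jiso : isometry ip ip J.

(** The pairing makes the Gram determinant a perfect square, which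
    cancels the square root. *)
Lemma cos_grassmann_with_J V W vs : V != 0%VS -> (J @: W)%VS = W ->
  onb ip V (with_J J vs) -> pip_diagonal ip W (with_J J vs) ->
  cos (grassmann_angle ip V W) = \prod_(v <- vs) pip ip W v v.
Proof.
move=> V0 JW bvs dvs; rewrite (cos_grassmann_angle _ V0 bvs).
rewrite det_pip_gram_diag ?(onb_size bvs) // prod_with_J //.
by rewrite sqrtr_sqr ger0_norm // prodr_ge0 // => v _; exact: pip_ge0.
Qed.

Lemma mem_with_J vs x :
  x \in with_J J vs -> exists2 v, v \in vs & x = v \/ x = J v.
Proof.
case/flatten_mapP=> v vvs; rewrite !inE => /orP[] /eqP ->; exists v => //;
by [left|right].
Qed.

Lemma sub_with_J vs v : v \in vs -> v \in with_J J vs.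
Proof. by move=> vvs; apply/flatten_mapP; exists v; rewrite ?mem_head. Qed.

Lemma size_with_J vs : size (with_J J vs) = (size vs).*2.
Proof. by elim: vs => //= v vs ->. Qed.

Lemma with_J_unit V vs v : onb ip V (with_J J vs) -> v \in vs -> ip v v = 1.
Proof. by case/andP=> _ /andP[/allP h _] /sub_with_J /h /eqP. Qed.

(** In a diagonalising basis the Rayleigh quotient is a weighted mean of the
    diagonal values. *)
Lemma pip_bounds V W vs lo hi v : (J @: W)%VS = W ->
  onb ip V (with_J J vs) -> pip_diagonal ip W (with_J J vs) ->
  (forall x, x \in vs -> lo <= pip ip W x x <= hi) ->
  v \in V -> lo * ip v v <= pip ip W v v <= hi * ip v v.
Proof.
move=> JW bvs dvs lohi vV.
rewrite (pip_diag_expand bvs dvs vV) (ip_onb v bvs vV) !mulr_sumr !big_seq.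
have h x : x \in with_J J vs -> lo <= pip ip W x x <= hi.
  by case/mem_with_J => y /lohi yb [->|->] //; rewrite pipJ.
apply/andP; split; apply: ler_sum => x /h /andP[l1 l2];
  rewrite (ipC _ x v) -expr2; last rewrite [leRHS]mulrC.
- by rewrite mulrC ler_wpM2l // sqr_ge0.
- by rewrite ler_wpM2l // sqr_ge0.
Qed.

(** As the diagonal values decrease along the list, its first vector a and last
    vector b carry the extreme ones A and B: these determine the angular range,
    and they are split off from the two products giving the Grassmann angles. *)
Lemma angles_with_J V W a b t : V != 0%VS -> W != 0%VS -> (J @: W)%VS = W ->
  let vs := a :: rcons t b in
  onb ip V (with_J J vs) -> pip_diagonal ip W (with_J J vs) ->
  sorted (fun u v => pip ip W v v <= pip ip W u u) vs ->
  let A := pip ip W a a in let B := pip ip W b b in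
  [/\ Num.sqrt (cos (grassmann_angle ip V W)) =
       Num.sqrt (A * B) * Num.sqrt (\prod_(v <- t) pip ip W v v),
     Num.sqrt (cos (complementary_grassmann_angle ip V W)) =
       Num.sqrt ((1 - A) * (1 - B)) *
       Num.sqrt (\prod_(v <- t) (1 - pip ip W v v)) &
     cos (angular_range ip V W) =
       Num.sqrt (A * B) + Num.sqrt ((1 - A) * (1 - B))].
Proof.
move=> V0 W0 JW vs bvs dvs svs A B.
have /andP[_ ovs] := bvs.
have unit v : v \in vs -> ip v v = 1 by exact: with_J_unit bvs.
have prodE (F : X -> R) : \prod_(v <- vs) F v = F a * F b * \prod_(v <- t) F v.
  by rewrite /vs big_cons -cats1 big_cat big_seq1 /= mulrCA mulrC -mulrA mulrC.
have avs : a \in vs by rewrite mem_head.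
have bvs' : b \in vs by rewrite inE mem_rcons mem_head orbT.
have g01 v : v \in vs -> 0 <= pip ip W v v <= 1.
  by move=> vvs; rewrite pip_ge0 -(unit v vvs) pip_le.
have /andP[A0 A1] := g01 a avs; have /andP[B0 B1] := g01 b bvs'.
split.
- by rewrite (cos_grassmann_with_J V0 JW bvs dvs) prodE sqrtrM // mulr_ge0.
- have JW' := J_orthov J2 Jiso JW.
  rewrite (cos_grassmann_with_J V0 JW' bvs (pip_diagonal_orthov ovs dvs)).
  have -> : \prod_(v <- vs) pip ip (orthov ip W) v v =
      \prod_(v <- vs) (1 - pip ip W v v).
    rewrite big_seq [RHS]big_seq; apply: eq_bigr => v vvs.
    by rewrite pip_orthov unit.
  by rewrite prodE sqrtrM // mulr_ge0 // subr_ge0.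
- have ba v : v \in vs -> B <= pip ip W v v <= A.
    pose r u v := pip ip W v v <= pip ip W u u.
    have r_trans : transitive r by move=> y x z yx zy; exact: le_trans zy yx.
    have dec : pairwise r vs by rewrite -sorted_pairwise.
    have := dec; rewrite /vs -rcons_cons pairwise_rcons => /andP[/allP lastr _].
    have := dec; rewrite /vs /= => /andP[/allP headr _] vvs.
    apply/andP; split.
      move: vvs; rewrite /vs -rcons_cons mem_rcons inE => /predU1P[->//|].
      exact: lastr.
    by move: vvs; rewrite inE => /predU1P[->//|]; exact: headr.
  have nz v : v \in vs -> nonzero_vectors V v.
    move=> vvs; split; first exact: (onb_mem bvs (sub_with_J vvs)).
    by rewrite -(ip_eq0 ip) unit // oner_neq0.
  have pc v : v \in vs -> proj_cos W v = Num.sqrt (pip ip W v v).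
    by move=> vvs; rewrite /proj_cos unit // divr1.
  rewrite (cos_angular_range W0 (nz a avs) (nz b bvs')).
    rewrite !pc // !sqr_sqrtr //.
    by rewrite -!sqrtrM ?subr_ge0 // mulrC [X in _ + Num.sqrt X]mulrC.
  move=> v [vV v0]; have v_gt0 := ip_gt0 ip v0.
  have /andP[lo hi] := pip_bounds JW bvs dvs ba vV.
  rewrite (pc a) // (pc b) // !ler_wsqrtr //.
    by rewrite ler_pdivrMr.
  by rewrite ler_pdivlMr.
Qed.
End J.
(** The numbers A and B and the entries of l are the values of the form on
    a basis adapted to J, one for each pair v, J v. The bound on dim V makes
    room for two pairs, so that A and B have separate places. *)
Lemma complexifiable_angles V W : V != 0%VS -> W != 0%VS ->
  (2 < \dim V)%N -> simultaneously_complexifiable ip V W ->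
  exists (A B : R) (l : seq R),
  [/\ \dim V = (size l).+2.*2, all (fun x : R => 0 <= x <= 1) l,
     Num.sqrt (cos (grassmann_angle ip V W)) =
       Num.sqrt (A * B) * Num.sqrt (\prod_(x <- l) x),
     Num.sqrt (cos (complementary_grassmann_angle ip V W)) =
       Num.sqrt ((1 - A) * (1 - B)) * Num.sqrt (\prod_(x <- l) (1 - x)) &
     cos (angular_range ip V W) =
       Num.sqrt (A * B) + Num.sqrt ((1 - A) * (1 - B))].
Proof.
move=> V0 W0 dV [J [[J2 Jiso] JV JW]].
have [vs [bvs dvs svs]] := complex_spectral J2 Jiso JV JW.
have := onb_size bvs; rewrite size_with_J => sz.
case: vs bvs dvs svs sz => [|a vs]; first by move=> _ _ _ sz; rewrite -sz in dV.
case/lastP: vs => [|t b] bvs dvs svs sz; first by rewrite -sz in dV.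
have [gE cE rE] := angles_with_J J2 Jiso V0 W0 JW bvs dvs svs.
exists (pip ip W a a), (pip ip W b b), [seq pip ip W v v | v <- t].
split; rewrite ?big_map //; first by rewrite -sz /= size_rcons size_map.
apply/allP => _ /mapP[v vt ->].
have v1 : ip v v = 1.
  by apply: (with_J_unit bvs); rewrite inE mem_rcons inE vt !orbT.
by rewrite pip_ge0 -v1 pip_le.
Qed.

End AngularRange.

Theorem proposition5p15 (R : realType) (X : vectType R)
  (ip : {dot X for idfun}) (V W : {vspace X}) :
  ~~ odd (\dim {:X}) ->
  V != 0%VS -> W != 0%VS ->
  ~~ odd (\dim V) -> ~~ odd (\dim W) ->
  (\dim V = 4%N ->
   Num.sqrt (cos (grassmann_angle ip V W))
   + Num.sqrt (cos (complementary_grassmann_angle ip V W))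
   <> cos (angular_range ip V W) ->
   ~ simultaneously_complexifiable ip V W) /\
  ((4 < \dim V)%N ->
   Num.sqrt (cos (grassmann_angle ip V W))
   + Num.sqrt (cos (complementary_grassmann_angle ip V W))
   > cos (angular_range ip V W) ->
   ~ simultaneously_complexifiable ip V W).
Proof.
move=> _ V0 W0 _ _; split=> dV hV /(complexifiable_angles V0 W0).
- rewrite dV => /(_ isT)[A [B [l [sl _ gE cE rE]]]]; apply: hV.
  have l0 : l = [::] by apply: size0nil; case: (size l) sl.
  by rewrite gE cE rE l0 !big_nil sqrtr1 !mulr1.
- case=> [|A [B [l [_ /allP l01 gE cE rE]]]]; first exact: ltn_trans dV.
  have sqrt_prod_le1 (F : R -> R) : (forall x, x \in l -> 0 <= F x <= 1) ->
      Num.sqrt (\prod_(x <- l) F x) <= 1.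
    move=> F01; rewrite -[leRHS]sqrtr1 ler_wsqrtr // big_seq.
    exact: prodr_ile1.
  move: hV; rewrite gE cE rE; apply/negP; rewrite -leNgt.
  by apply: lerD; rewrite ler_piMr ?sqrtr_ge0 //; apply: sqrt_prod_le1 => x;
    move=> /l01 /andP[h0 h1]; rewrite ?subr_ge0 ?gerBl h0 h1.
Qed.
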